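(* Let $\mathcal{D}=(D,<,\approx)$, where $D$ is an infinite set, $<$ is a strict total order on $D$, and $\approx$ is equality. Then the satisfiability problems for $\mathrm{LRC}(\mathcal{D})$ and for $\mathrm{LRC}^{\top}(\mathcal{D})$ are undecidable.
   Context: Variables range over a countably infinite set $V$. A model is an infinite sequence $\sigma$ of maps $V\to D$. A formula $\phi$ is satisfiable iff $\sigma,0\models\phi$ for some model $\sigma$. $\mathrm{LRC}^{\top}(\mathcal{D})$ formulas are given by $\phi::= x\approx\mathbf{X}^iy \mid x\approx\mathbf{XF}y \mid x\approx\mathbf{XF}^{-1}y \mid x<\mathbf{XF}y \mid x>\mathbf{XF}y \mid \phi\wedge\phi\mid\neg\phi\mid\mathbf{X}\phi\mid\phi\mathbf{U}\phi$, with $x,y\in V$ and $i\in\mathbb{N}$. $\mathrm{LRC}(\mathcal{D})$ formulas are given by $\phi::= x\approx\mathbf{X}^iy \mid x\approx\langle\phi?\rangle y \mid x\approx\langle\phi?\rangle^{-1}y \mid x<\mathbf{XF}y \mid x>\mathbf{XF}y \mid \phi\wedge\phi\mid\neg\phi\mid\mathbf{X}\phi\mid\phi\mathbf{U}\phi\mid\mathbf{X}^{-1}\phi\mid\phi\mathbf{S}\phi$. Semantics: - $\sigma,i\models x\approx\mathbf{X}^jy$ iff $\sigma(i)(x)=\sigma(i+j)(y)$. - $\sigma,i\models x\approx\mathbf{XF}y$ iff there is $j>i$ with $\sigma(i)(x)=\sigma(j)(y)$. - $\sigma,i\models x\approx\mathbf{XF}^{-1}y$ iff there is $0\le j<i$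 with $\sigma(i)(x)=\sigma(j)(y)$. - $\sigma,i\models x<\mathbf{XF}y$ iff there is $j>i$ with $\sigma(i)(x)<\sigma(j)(y)$. - $\sigma,i\models x>\mathbf{XF}y$ iff there is $j>i$ with $\sigma(i)(x)>\sigma(j)(y)$. - $\sigma,i\models x\approx\langle\psi?\rangle y$ iff there is $j>i$ with $\sigma(i)(x)=\sigma(j)(y)$ and $\sigma,j\models\psi$. - $\sigma,i\models x\approx\langle\psi?\rangle^{-1}y$ iff there is $0\le j<i$ with $\sigma(i)(x)=\sigma(j)(y)$ and $\sigma,j\models\psi$. - Boolean connectives and $\mathbf{X},\mathbf{U}$ are as in LTL. - $\sigma,i\models\mathbf{X}^{-1}\phi$ iff $i\ge1$ and $\sigma,i-1\models\phi$. - $\sigma,i\models\phi\mathbf{S}\phi'$ iff there is $j\le i$ with $\sigma,j\models\phi'$ and $\sigma,k\models\phi$ for all $j<k\le i$. *)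

(* Defs.v *)
From Stdlib Require Import List Arith.
Import ListNotations.

Definition strict_total_order {D : Type} (lt : D -> D -> Prop) : Prop :=
  (forall x, ~ lt x x) /\
  (forall x y z, lt x y -> lt y z -> lt x z) /\
  (forall x y, x <> y -> lt x y \/ lt y x).

Definition infinite_type (D : Type) : Prop :=
  forall l : list D, exists d : D, ~ In d l.

Definition var := nat.

Definition model (D : Type) := nat -> var -> D.

Inductive lrcT : Type :=
| T_EqX   (x : var) (i : nat) (y : var)
| T_EqXF  (x y : var)
| T_EqXFi (x y : var)
| T_LtXF  (x y : var)
| T_GtXF  (x y : var)
| T_And   (a b : lrcT)
| T_Not   (a : lrcT)
| T_Next  (a : lrcT)
| T_Until (a b : lrcT).

Fixpoint satT {D : Type} (lt : D -> D -> Prop) (s : model D) (i : nat) (f : lrcT)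
  : Prop :=
  match f with
  | T_EqX x k y => s i x = s (i + k) y
  | T_EqXF x y => exists j, i < j /\ s i x = s j y
  | T_EqXFi x y => exists j, j < i /\ s i x = s j y
  | T_LtXF x y => exists j, i < j /\ lt (s i x) (s j y)
  | T_GtXF x y => exists j, i < j /\ lt (s j y) (s i x)
  | T_And a b => satT lt s i a /\ satT lt s i b
  | T_Not a => ~ satT lt s i a
  | T_Next a => satT lt s (S i) a
  | T_Until a b =>
      exists j, i <= j /\ satT lt s j b /\ (forall k, i <= k -> k < j -> satT lt s k a)
  end.

Definition satisfiableT {D : Type} (lt : D -> D -> Prop) (f : lrcT) : Prop :=
  exists s : model D, satT lt s 0 f.

Inductive lrc : Type :=
| L_EqX   (x : var) (i : nat) (y : var)
| L_EqTF  (x : var) (p : lrc) (y : var)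
| L_EqTP  (x : var) (p : lrc) (y : var)
| L_LtXF  (x y : var)
| L_GtXF  (x y : var)
| L_And   (a b : lrc)
| L_Not   (a : lrc)
| L_Next  (a : lrc)
| L_Until (a b : lrc)
| L_Prev  (a : lrc)
| L_Since (a b : lrc).

Fixpoint satL {D : Type} (lt : D -> D -> Prop) (s : model D) (i : nat) (f : lrc)
  : Prop :=
  match f with
  | L_EqX x k y => s i x = s (i + k) y
  | L_EqTF x p y => exists j, i < j /\ s i x = s j y /\ satL lt s j p
  | L_EqTP x p y => exists j, j < i /\ s i x = s j y /\ satL lt s j p
  | L_LtXF x y => exists j, i < j /\ lt (s i x) (s j y)
  | L_GtXF x y => exists j, i < j /\ lt (s j y) (s i x)
  | L_And a b => satL lt s i a /\ satL lt s i b
  | L_Not a => ~ satL lt s i a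
  | L_Next a => satL lt s (S i) a
  | L_Until a b =>
      exists j, i <= j /\ satL lt s j b /\ (forall k, i <= k -> k < j -> satL lt s k a)
  | L_Prev a => 1 <= i /\ satL lt s (i - 1) a
  | L_Since a b =>
      exists j, j <= i /\ satL lt s j b /\ (forall k, j < k -> k <= i -> satL lt s k a)
  end.

Definition satisfiableL {D : Type} (lt : D -> D -> Prop) (f : lrc) : Prop :=
  exists s : model D, satL lt s 0 f.

Inductive prf : Type :=
| PZero
| PSucc
| PProj (n : nat)
| PComp (f : prf) (gs : list prf)
| PRec (f g : prf)
| PMu (f : prf).

(* Big-step evaluation: [eval f v y] means f halts on argument list v with
   output y (missing arguments read as 0). *)
Inductive eval : prf -> list nat -> nat -> Prop :=
| ev_zero v : eval PZero v 0
| ev_succ v : eval PSucc v (S (nth 0 v 0))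
| ev_proj n v : eval (PProj n) v (nth n v 0)
| ev_comp f gs v ws y : evalL gs v ws -> eval f ws y -> eval (PComp f gs) v y
| ev_rec0 f g v y : eval f v y -> eval (PRec f g) (0 :: v) y
| ev_recS f g n v z y :
    eval (PRec f g) (n :: v) z -> eval g (n :: z :: v) y ->
    eval (PRec f g) (S n :: v) y
| ev_mu f v n :
    eval f (n :: v) 0 -> (forall m, m < n -> exists k, eval f (m :: v) (S k)) ->
    eval (PMu f) v n
with evalL : list prf -> list nat -> list nat -> Prop :=
| evL_nil v : evalL [] v []
| evL_cons g gs v w ws : eval g v w -> evalL gs v ws -> evalL (g :: gs) v (w :: ws).

Definition cpair (a b : nat) : nat := (a + b) * (a + b + 1) / 2 + b.

Fixpoint code_lrcT (f : lrcT) : nat :=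
  match f with
  | T_EqX x i y => cpair 0 (cpair x (cpair i y))
  | T_EqXF x y => cpair 1 (cpair x y)
  | T_EqXFi x y => cpair 2 (cpair x y)
  | T_LtXF x y => cpair 3 (cpair x y)
  | T_GtXF x y => cpair 4 (cpair x y)
  | T_And a b => cpair 5 (cpair (code_lrcT a) (code_lrcT b))
  | T_Not a => cpair 6 (code_lrcT a)
  | T_Next a => cpair 7 (code_lrcT a)
  | T_Until a b => cpair 8 (cpair (code_lrcT a) (code_lrcT b))
  end.

Fixpoint code_lrc (f : lrc) : nat :=
  match f with
  | L_EqX x i y => cpair 0 (cpair x (cpair i y))
  | L_EqTF x p y => cpair 1 (cpair x (cpair (code_lrc p) y))
  | L_EqTP x p y => cpair 2 (cpair x (cpair (code_lrc p) y))
  | L_LtXF x y => cpair 3 (cpair x y)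
  | L_GtXF x y => cpair 4 (cpair x y)
  | L_And a b => cpair 5 (cpair (code_lrc a) (code_lrc b))
  | L_Not a => cpair 6 (code_lrc a)
  | L_Next a => cpair 7 (code_lrc a)
  | L_Until a b => cpair 8 (cpair (code_lrc a) (code_lrc b))
  | L_Prev a => cpair 9 (code_lrc a)
  | L_Since a b => cpair 10 (cpair (code_lrc a) (code_lrc b))
  end.

Definition decidable_pred {X : Type} (enc : X -> nat) (P : X -> Prop) : Prop :=
  exists f : prf, forall x : X,
    (P x -> eval f [enc x] 1) /\ (~ P x -> eval f [enc x] 0).

(* Main.v *)
(** By diagonalization. Suppose that a program [f] decides satisfiability. The
    halting of a program on input [m] is expressed by the satisfiability of
    [T_And psi (input_form m)], where [psi] depends on the program only, so that
    the code of this formula is an easy function of [m] and of the code of [psi].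
    Let [d] halt on [m] iff [f] answers 0 on that formula for [psi] of code [m];
    taking for [psi] the formula of [d] itself and for [m] its code contradicts
    the correctness of [f].

    Programs are compiled to register machines. In a formula, a register is a
    first-in first-out queue of values of a strictly increasing clock: an
    increment enqueues the next clock value, a decrement dequeues one.
    Dequeued values are nondecreasing, every enqueued value is dequeued at some
    time, and a dequeued value is a past enqueued one, so no element is skipped;
    at a zero test the last dequeued value jumps to the clock, which is possible
    iff the queue is empty. A halting run needs finitely many values only, and a
    finite chain of any length exists in every infinite total order. *)

Require Import Defs.
From Stdlib Require Import List Arith Bool Lia Classical FunctionalExtensionality Sorted.
Import ListNotations.

(** * Compilation of recursive functions to while programs *)

Definition upd (s : nat -> nat) (r x : nat) : nat -> nat :=
  fun k => if Nat.eq_dec k r then x else s k.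

Inductive cmd : Type :=
| Inc (r : nat)
| Dec (r : nat)
| Seq (a b : cmd)
| While (r : nat) (b : cmd).

Inductive run : cmd -> (nat -> nat) -> (nat -> nat) -> Prop :=
| run_inc r s : run (Inc r) s (upd s r (S (s r)))
| run_dec r s : run (Dec r) s (upd s r (pred (s r)))
| run_seq a b s s1 s2 : run a s s1 -> run b s1 s2 -> run (Seq a b) s s2
| run_while_zero r b s : s r = 0 -> run (While r b) s s
| run_while_step r b s s1 s2 :
    s r <> 0 -> run b s s1 -> run (While r b) s1 s2 -> run (While r b) s s2.

Definition clear (r : nat) : cmd := While r (Dec r).

Definition move (r d : nat) : cmd := While r (Seq (Dec r) (Inc d)).

(** The source is drained into both [d] and the scratch register [t], then restored from [t]. *)
Definition copy (r d t : nat) : cmd :=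
  Seq (While r (Seq (Dec r) (Seq (Inc d) (Inc t)))) (move t r).

Ltac state_eq :=
  let k := fresh "k" in
  apply functional_extensionality; intros k; unfold upd;
  repeat (destruct Nat.eq_dec; try lia); subst; auto; try lia.

Lemma run_eq (c : cmd) (s s1 s2 : nat -> nat) : run c s s1 -> s1 = s2 -> run c s s2.
Proof. intros H <-. exact H. Qed.

Lemma run_clear (r : nat) (s : nat -> nat) : run (clear r) s (upd s r 0).
Proof.
  remember (s r) as n eqn:E. revert s E.
  induction n as [|n IH]; intros s E.
  - eapply run_eq. apply run_while_zero; auto. state_eq.
  - eapply run_while_step; [lia|apply run_dec|].
    eapply run_eq. apply IH. unfold upd; destruct Nat.eq_dec; lia.
    state_eq.
Qed.

Lemma run_move (r d : nat) (s : nat -> nat) :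
  r <> d -> run (move r d) s (upd (upd s d (s d + s r)) r 0).
Proof.
  intros H. remember (s r) as n eqn:E. revert s E.
  induction n as [|n IH]; intros s E.
  - eapply run_eq. apply run_while_zero; auto. state_eq.
  - eapply run_while_step; [lia|eapply run_seq; constructor|].
    eapply run_eq. apply IH. unfold upd; repeat (destruct Nat.eq_dec; try lia).
    state_eq.
Qed.

Lemma run_copy (r d t : nat) (s : nat -> nat) :
  r <> d -> r <> t -> d <> t -> s d = 0 -> s t = 0 ->
  run (copy r d t) s (upd s d (s r)).
Proof.
  intros H1 H2 H3 Hd Ht.
  assert (L : forall n s, s r = n -> run (While r (Seq (Dec r) (Seq (Inc d) (Inc t)))) s
    (upd (upd (upd s d (s d + n)) t (s t + n)) r 0)).
  { clear s Hd Ht. induction n as [|n IH]; intros s E.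
    - eapply run_eq. apply run_while_zero; auto. state_eq.
    - eapply run_while_step; [lia|eapply run_seq; [constructor|eapply run_seq; constructor]|].
      eapply run_eq. apply IH. unfold upd; repeat (destruct Nat.eq_dec; try lia).
      state_eq. }
  eapply run_seq. apply L; reflexivity.
  eapply run_eq. apply run_move; auto. state_eq.
Qed.

Fixpoint clear_range (n k : nat) : cmd :=
  match k with
  | 0 => clear n
  | S k => Seq (clear n) (clear_range (S n) k)
  end.

Lemma run_clear_range (k n : nat) (s : nat -> nat) :
  run (clear_range n k) s (fun j => if (n <=? j) && (j <=? n + k) then 0 else s j).
Proof.
  revert n s. induction k as [|k IH]; intros n s; simpl.
  - eapply run_eq. apply run_clear. apply functional_extensionality; intros j.
    unfold upd. destruct (Nat.leb_spec n j), (Nat.leb_spec j (n + 0)), (Nat.eq_dec j n);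
      simpl; auto; lia.
  - eapply run_seq. apply run_clear. eapply run_eq. apply IH.
    apply functional_extensionality; intros j. unfold upd.
    destruct (Nat.leb_spec n j), (Nat.leb_spec (S n) j), (Nat.leb_spec j (S n + k)),
      (Nat.leb_spec j (n + S k)), (Nat.eq_dec j n); simpl; auto; lia.
Qed.

(** [Dec n] serves as a skip command: register [n] is zero at this point, and zero is the value of a
    missing argument. *)
Definition copy_arg (args : list nat) (i n : nat) : cmd :=
  match nth_error args i with
  | Some a => copy a n (S n)
  | None => Dec n
  end.

(* [compile f args n] reads its arguments in the registers [args], all below [n],
   expects the registers from [n] on to be zero, and changes only register [n],
   which receives the result. *)
Fixpoint compile (f : prf) (args : list nat) (n : nat) : cmd :=
  match f with
  | PZero => Dec n
  | PSucc => Seq (copy_arg args 0 n) (Inc n)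
  | PProj i => copy_arg args i n
  | PComp f gs =>
      let k := length gs in
      Seq ((fix go (gs : list prf) (n : nat) : cmd :=
              match gs with
              | [] => Dec n
              | g :: gs => Seq (compile g args n) (go gs (S n))
              end) gs n)
        (Seq (compile f (seq n k) (S (n + k)))
          (Seq (clear_range n k) (move (S (n + k)) n)))
  | PRec f g =>
      match args with
      | [] => Dec n
      | a :: args =>
          Seq (compile f args n)
            (Seq (copy a (n + 2) (n + 3))
              (Seq (While (n + 2)
                     (Seq (Dec (n + 2))
                       (Seq (compile g (n + 1 :: n :: args) (n + 3))
                         (Seq (clear n) (Seq (move (n + 3) n) (Inc (n + 1)))))))
                (clear (n + 1))))
      end
  | PMu f =>
      Seq (compile f (n :: args) (S n))
        (While (S n) (Seq (clear (S n)) (Seq (Inc n) (compile f (n :: args) (S n)))))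
  end.

(** The local fixpoint inside [compile], given a name so that lemmas can speak of it. *)
Definition compile_list (args : list nat) : list prf -> nat -> cmd :=
  fix go (gs : list prf) (n : nat) : cmd :=
    match gs with
    | [] => Dec n
    | g :: gs => Seq (compile g args n) (go gs (S n))
    end.

Lemma compile_comp (f : prf) (gs : list prf) (args : list nat) (n : nat) :
  compile (PComp f gs) args n =
  Seq (compile_list args gs n)
    (Seq (compile f (seq n (length gs)) (S (n + length gs)))
      (Seq (clear_range n (length gs)) (move (S (n + length gs)) n))).
Proof. reflexivity. Qed.

Definition compiles (f : prf) : Prop :=
  forall v y, eval f v y ->
  forall s args n, (forall k, n <= k -> s k = 0) -> (forall a, In a args -> a < n) ->
  v = map s args -> run (compile f args n) s (upd s n y).

Lemma map_upd_fresh (s : nat -> nat) (args : list nat) (n x : nat) :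
  (forall a, In a args -> a < n) -> map (upd s n x) args = map s args.
Proof.
  intros H. apply map_ext_in. intros a Ha. specialize (H a Ha).
  unfold upd; destruct Nat.eq_dec; lia.
Qed.

Lemma run_copy_arg (s : nat -> nat) (args : list nat) (i n : nat) :
  (forall k, n <= k -> s k = 0) -> (forall a, In a args -> a < n) ->
  run (copy_arg args i n) s (upd s n (nth i (map s args) 0)).
Proof.
  intros Hz Ha. unfold copy_arg. destruct (nth_error args i) as [a|] eqn:E.
  - rewrite (nth_indep _ 0 (s 0)), map_nth.
    + rewrite (nth_error_nth _ _ 0 E). apply nth_error_In in E. specialize (Ha _ E).
      apply run_copy; try lia; apply Hz; lia.
    + rewrite length_map. apply nth_error_Some. congruence.
  - eapply run_eq. constructor. rewrite Hz by lia. rewrite nth_overflow; auto.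
    rewrite length_map. now apply nth_error_None.
Qed.

Fixpoint upd_list (s : nat -> nat) (n : nat) (ws : list nat) : nat -> nat :=
  match ws with
  | [] => s
  | w :: ws => upd_list (upd s n w) (S n) ws
  end.

Lemma upd_list_outside (ws : list nat) (s : nat -> nat) (n k : nat) :
  k < n \/ n + length ws <= k -> upd_list s n ws k = s k.
Proof.
  revert s n. induction ws as [|w ws IH]; simpl; intros s n H; auto.
  rewrite IH by lia. unfold upd; destruct Nat.eq_dec; lia.
Qed.

Lemma map_upd_list (ws : list nat) (s : nat -> nat) (n : nat) :
  map (upd_list s n ws) (seq n (length ws)) = ws.
Proof.
  revert s n. induction ws as [|w ws IH]; simpl; intros s n; auto.
  rewrite IH, upd_list_outside by lia. unfold upd. destruct Nat.eq_dec; congruence.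
Qed.

Lemma compile_list_correct (gs : list prf) (v ws : list nat) (s : nat -> nat)
    (args : list nat) (n : nat) :
  Forall compiles gs -> evalL gs v ws ->
  (forall k, n <= k -> s k = 0) -> (forall a, In a args -> a < n) -> v = map s args ->
  run (compile_list args gs n) s (upd_list s n ws).
Proof.
  intros HF. revert ws s n. induction HF as [|g gs Hg _ IH]; intros ws s n He Hz Ha Hv;
    inversion He; subst; simpl.
  - eapply run_eq. constructor. state_eq. now rewrite Hz.
  - eapply run_seq. eapply Hg; eauto. apply IH; auto.
    + intros k Hk. unfold upd; destruct Nat.eq_dec; [lia|apply Hz; lia].
    + intros a H. specialize (Ha a H). lia.
    + now rewrite map_upd_fresh.
Qed.

Lemma evalL_length (gs : list prf) (v ws : list nat) : evalL gs v ws -> length ws = length gs.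
Proof.
  revert ws. induction gs; intros ws H; inversion H; subst; simpl; auto.
Qed.

Lemma compiles_comp (f : prf) (gs : list prf) :
  compiles f -> Forall compiles gs -> compiles (PComp f gs).
Proof.
  intros Hf Hgs v y He s args n Hz Ha Hv. rewrite compile_comp.
  inversion He; subst.
  match goal with H : evalL _ _ _ |- _ => rename H into HL end.
  assert (E := evalL_length _ _ _ HL).
  eapply run_seq. eapply compile_list_correct; eauto.
  eapply run_seq. eapply Hf; eauto.
  - intros k Hk. rewrite upd_list_outside by lia. apply Hz; lia.
  - intros a H. apply in_seq in H. lia.
  - rewrite <- E. now rewrite map_upd_list.
  - eapply run_seq. apply run_clear_range. eapply run_eq. apply run_move. lia.
    apply functional_extensionality; intros k. unfold upd.
    destruct (Nat.leb_spec n k), (Nat.leb_spec k (n + length gs)),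
      (Nat.leb_spec n n), (Nat.leb_spec n (n + length gs)),
      (Nat.leb_spec n (S (n + length gs))), (Nat.leb_spec (S (n + length gs)) (n + length gs));
      simpl; try lia;
      repeat (destruct Nat.eq_dec; simpl; try lia); try rewrite upd_list_outside by lia; auto;
      try (rewrite Hz; lia).
Qed.

Lemma compiles_rec (f g : prf) : compiles f -> compiles g -> compiles (PRec f g).
Proof.
  intros Hf Hg v y He s args n Hz Ha Hv.
  destruct args as [|a args].
  { simpl in Hv; subst v. inversion He. }
  simpl in Hv. subst v. simpl compile. set (W := While (n + 2) _).
  assert (Hargs : forall x, In x args -> x < n) by (intros; apply Ha; simpl; auto).
  assert (Han : a < n) by (apply Ha; simpl; auto).
  (* State of the loop: [n] holds the value computed so far, [n + 1] the index, [n + 2] the number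
     of rounds left. *)
  pose (st z i r := upd (upd (upd s n z) (n + 1) i) (n + 2) r).
  (* Induction on [m] peels off the last round, while [run] unfolds a loop from its first. Hence the
     claim prepends the first [m] rounds to an arbitrary run. *)
  assert (L : forall m z, eval (PRec f g) (m :: map s args) z ->
    exists zi, eval f (map s args) zi /\
      forall r s', run W (st z m r) s' -> run W (st zi 0 (m + r)) s').
  { induction m as [|m IH]; intros z Hz'; inversion Hz'; subst.
    - eexists; split; eauto.
    - match goal with H : eval (PRec _ _) _ _ |- _ => destruct (IH _ H) as (zi & Hzi & HW) end.
      exists zi; split; auto. intros r s' Hr. replace (S m + r) with (m + S r) by lia.
      apply HW. eapply run_while_step with (s1 := st z (S m) r); auto.
      { unfold st, upd. repeat (destruct Nat.eq_dec; try lia). }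
      eapply run_seq. constructor.
      eapply run_seq.
      { eapply Hg; eauto.
        - intros k Hk. unfold st, upd. repeat (destruct Nat.eq_dec; try lia). apply Hz; lia.
        - simpl. intros x [<-|[<-|Hx]]; try lia. specialize (Hargs _ Hx). lia.
        - simpl. f_equal; [|f_equal].
          + unfold st, upd. repeat (destruct Nat.eq_dec; try lia).
          + unfold st, upd. repeat (destruct Nat.eq_dec; try lia).
          + apply map_ext_in. intros x Hx. specialize (Hargs _ Hx).
            unfold st, upd. repeat (destruct Nat.eq_dec; try lia). }
      eapply run_seq. apply run_clear.
      eapply run_seq. apply run_move. lia.
      eapply run_eq. constructor. unfold st. state_eq; rewrite Hz; lia. }
  destruct (L _ _ He) as (zi & Hzi & HW).
  eapply run_seq. eapply Hf; eauto.
  eapply run_seq.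
  { apply run_copy; try lia; unfold upd; repeat (destruct Nat.eq_dec; try lia); apply Hz; lia. }
  eapply run_seq.
  - eapply run_eq with (s1 := st y (s a) 0); [|reflexivity].
    match goal with |- run W ?x _ => replace x with (st zi 0 (s a + 0)) end.
    + apply HW. constructor. unfold st, upd. repeat (destruct Nat.eq_dec; try lia).
    + unfold st. state_eq; rewrite Hz; lia.
  - eapply run_eq. apply run_clear. unfold st. state_eq; rewrite Hz; lia.
Qed.

Lemma compiles_mu (f : prf) : compiles f -> compiles (PMu f).
Proof.
  intros Hf v y He s args n Hz Ha Hv. subst v. inversion He; subst. simpl.
  set (W := While (S n) _).
  match goal with H : eval f (y :: _) 0 |- _ => rename H into H0 end.
  match goal with H : forall m, m < y -> _ |- _ => rename H into Hlt end.
  assert (F : forall i z, eval f (i :: map s args) z ->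
    run (compile f (n :: args) (S n)) (upd s n i) (upd (upd s n i) (S n) z)).
  { intros i z Hi. eapply Hf; eauto.
    - intros k Hk. unfold upd. repeat (destruct Nat.eq_dec; try lia). apply Hz; lia.
    - simpl. intros x [<-|Hx]; try lia. specialize (Ha _ Hx). lia.
    - simpl. rewrite map_upd_fresh by auto. f_equal. unfold upd; destruct Nat.eq_dec; lia. }
  (* [d] is the distance from the candidate [i] to the result [y]; the test value [z] vanishes
     exactly when [d] does. *)
  assert (L : forall d i z, i + d = y -> eval f (i :: map s args) z ->
    (d = 0 -> z = 0) -> (d <> 0 -> z <> 0) ->
    run W (upd (upd s n i) (S n) z) (upd s n y)).
  { induction d as [|d IH]; intros i z E Hi Hz0 Hz1.
    - rewrite Hz0 by auto. eapply run_eq. apply run_while_zero.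
      + unfold upd; repeat (destruct Nat.eq_dec; try lia).
      + state_eq; rewrite Hz; lia.
    - assert (exists z', eval f (S i :: map s args) z' /\ (d = 0 -> z' = 0) /\ (d <> 0 -> z' <> 0))
        as (z' & Hz' & Hd0 & Hd1).
      { destruct d.
        - exists 0. replace (S i) with y by lia. auto.
        - destruct (Hlt (S i)) as [k Hk]; [lia|]. exists (S k). repeat split; auto; lia. }
      eapply run_while_step.
      + unfold upd; repeat (destruct Nat.eq_dec; try lia).
      + eapply run_seq. apply run_clear. eapply run_seq. constructor.
        match goal with |- run _ ?x _ => replace x with (upd s n (S i)) end.
        * apply F. exact Hz'.
        * state_eq; rewrite Hz; lia.
      + apply IH; auto; lia. }
  assert (exists z, eval f (0 :: map s args) z /\ (y = 0 -> z = 0) /\ (y <> 0 -> z <> 0))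
    as (z & Hz' & Hd0 & Hd1).
  { destruct y.
    - exists 0. auto.
    - destruct (Hlt 0) as [k Hk]; [lia|]. exists (S k). repeat split; auto; lia. }
  eapply run_seq.
  - replace s with (upd s n 0) at 1. apply F; eauto. state_eq. symmetry. apply Hz; lia.
  - apply (L y); auto.
Qed.

Lemma compile_correct (f : prf) : compiles f.
Proof.
  (* The generated induction principle has no hypothesis for the list in [PComp]; the recursion
     reaches its members through the inner induction on [gs]. *)
  revert f. fix IH 1. intros [| |i|f gs|f g|f].
  - intros v y He s args n Hz Ha Hv. inversion He; subst. simpl.
    eapply run_eq. constructor. now rewrite Hz.
  - intros v y He s args n Hz Ha Hv. inversion He; subst. simpl.
    eapply run_seq. apply run_copy_arg; auto. eapply run_eq. constructor. state_eq.
  - intros v y He s args n Hz Ha Hv. inversion He; subst. simpl. apply run_copy_arg; auto.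
  - apply compiles_comp; auto. induction gs as [|g gs IHgs]; constructor; auto.
  - apply compiles_rec; auto.
  - apply compiles_mu; auto.
Qed.

(** * Register machines *)

Inductive instr : Type :=
| INC (r l : nat)
| DEC (r lz ln : nat).

Fixpoint clen (c : cmd) : nat :=
  match c with
  | Inc _ | Dec _ => 1
  | Seq a b => clen a + clen b
  | While _ b => 2 + clen b
  end.

(* [flat c o ex] is the code of [c] placed at address [o] and continuing at [ex]. *)
Fixpoint flat (c : cmd) (o ex : nat) : list instr :=
  match c with
  | Inc r => [INC r ex]
  | Dec r => [DEC r ex ex]
  | Seq a b => flat a o (o + clen a) ++ flat b (o + clen a) ex
  | While r b => DEC r ex (o + 1) :: INC r (o + 2) :: flat b (o + 2) o
  end.

Definition config : Type := (nat * (nat -> nat))%type.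

Definition step (P : list instr) (x : config) : config :=
  let (pc, s) := x in
  match nth_error P pc with
  | None => x
  | Some (INC r l) => (l, upd s r (S (s r)))
  | Some (DEC r lz ln) => if s r =? 0 then (lz, s) else (ln, upd s r (pred (s r)))
  end.

Definition steps (P : list instr) (k : nat) (x : config) : config := Nat.iter k (step P) x.

Definition reach (P : list instr) (x y : config) : Prop := exists k, steps P k x = y.

Definition start (m : nat) : config := (0, upd (fun _ => 0) 0 m).

Definition halted (P : list instr) (x : config) : Prop := nth_error P (fst x) = None.

Definition halts (P : list instr) (m : nat) : Prop := exists k, halted P (steps P k (start m)).

Lemma steps_add (P : list instr) (j k : nat) (x : config) :
  steps P (j + k) x = steps P j (steps P k x).
Proof. apply Nat.iter_add. Qed.

Lemma steps_halted (P : list instr) (k : nat) (x : config) : halted P x -> steps P k x = x.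
Proof.
  intros H. induction k as [|k IH]; auto. unfold steps in *. simpl. rewrite IH.
  destruct x as [pc s]. unfold halted in H. simpl in *. now rewrite H.
Qed.

Lemma reach_refl (P : list instr) (x : config) : reach P x x.
Proof. now exists 0. Qed.

Lemma reach_trans (P : list instr) (x y z : config) : reach P x y -> reach P y z -> reach P x z.
Proof. intros [j <-] [k <-]. exists (k + j). apply steps_add. Qed.

Lemma reach_step (P : list instr) (x y z : config) : step P x = y -> reach P y z -> reach P x z.
Proof. intros <-. apply reach_trans. now exists 1. Qed.

Lemma flat_length (c : cmd) (o ex : nat) : length (flat c o ex) = clen c.
Proof.
  revert o ex. induction c; intros o ex; simpl; auto.
  rewrite length_app. auto.
Qed.

Lemma nth_error_mid {A : Type} (l1 l2 : list A) (a : A) (n : nat) :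
  n = length l1 -> nth_error (l1 ++ a :: l2) n = Some a.
Proof. intros ->. induction l1; simpl; auto. Qed.

(** The surrounding code [A] and [B] is arbitrary, so that the induction hypotheses apply to
    subcommands in place. *)
Lemma flat_correct (c : cmd) (s s' : nat -> nat) :
  run c s s' -> forall A B o ex, length A = o ->
  reach (A ++ flat c o ex ++ B) (o, s) (ex, s').
Proof.
  induction 1 as [r s|r s|a b s s1 s2 _ IHa _ IHb|r b s E|r b s s1 s2 E Hb IHb Hw IHw];
    intros A B o ex Ho; simpl.
  - eapply reach_step; [|apply reach_refl]. simpl. now rewrite nth_error_mid.
  - eapply reach_step; [|apply reach_refl]. simpl. rewrite nth_error_mid by auto.
    destruct (Nat.eqb_spec (s r) 0) as [E|E]; auto. f_equal. state_eq.
  - rewrite <- app_assoc. eapply reach_trans. apply IHa; auto.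
    rewrite app_assoc. apply IHb. rewrite length_app, flat_length. lia.
  - eapply reach_step; [|apply reach_refl]. simpl. rewrite nth_error_mid by auto.
    apply Nat.eqb_eq in E. now rewrite E.
  - eapply reach_step.
    { simpl. rewrite nth_error_mid by auto. apply Nat.eqb_neq in E. rewrite E. reflexivity. }
    eapply reach_step.
    { simpl.
      change (A ++ ?i :: ?j :: ?l) with (A ++ [i] ++ j :: l). rewrite app_assoc.
      rewrite nth_error_mid; [reflexivity|rewrite length_app; simpl; lia]. }
    replace (upd _ r _) with s.
    + eapply reach_trans.
      * match goal with |- reach (A ++ ?i :: ?j :: ?l) _ _ =>
          change (A ++ i :: j :: l) with (A ++ [i; j] ++ l) end. rewrite app_assoc.
        apply IHb. rewrite length_app. simpl. lia.
      * apply IHw; auto.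
    + state_eq.
Qed.

(* If the result in register 1 is not zero, the last instruction loops forever. *)
Definition halt_on_zero (f : prf) : list instr :=
  let c := compile f [0] 1 in
  let o := clen c in
  flat c 0 o ++ [DEC 1 (o + 2) (o + 1); INC 0 (o + 1)].

Lemma halt_on_zero_reach (f : prf) (m y : nat) :
  eval f [m] y ->
  reach (halt_on_zero f) (start m) (clen (compile f [0] 1), upd (snd (start m)) 1 y).
Proof.
  intros H. unfold halt_on_zero. apply (flat_correct _ _ _) with (A := []); auto.
  eapply compile_correct; eauto.
  - intros k Hk. simpl. unfold upd; destruct Nat.eq_dec; lia.
  - simpl. intros a [<-|[]]. lia.
Qed.

Lemma halt_on_zero_test (f : prf) (o := clen (compile f [0] 1)) :
  nth_error (halt_on_zero f) o = Some (DEC 1 (o + 2) (o + 1)).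
Proof. apply nth_error_mid. now rewrite flat_length. Qed.

Lemma halt_on_zero_loop (f : prf) (o := clen (compile f [0] 1)) :
  nth_error (halt_on_zero f) (o + 1) = Some (INC 0 (o + 1)).
Proof.
  unfold halt_on_zero. change (?l ++ [?a; ?b]) with (l ++ [a] ++ [b]). rewrite app_assoc.
  apply nth_error_mid. now rewrite length_app, flat_length.
Qed.

Lemma halt_on_zero_length (f : prf) : length (halt_on_zero f) = clen (compile f [0] 1) + 2.
Proof. unfold halt_on_zero. now rewrite length_app, flat_length. Qed.

Lemma halt_on_zero_halts (f : prf) (m : nat) : eval f [m] 0 -> halts (halt_on_zero f) m.
Proof.
  intros H. destruct (halt_on_zero_reach _ _ _ H) as [k Hk]. exists (1 + k).
  rewrite steps_add, Hk. unfold steps, halted. simpl Nat.iter. unfold step.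
  rewrite halt_on_zero_test. simpl.
  apply nth_error_None. now rewrite halt_on_zero_length.
Qed.

Lemma halt_on_zero_loops (f : prf) (m y : nat) : eval f [m] (S y) -> ~ halts (halt_on_zero f) m.
Proof.
  intros H [j Hj]. destruct (halt_on_zero_reach _ _ _ H) as [k Hk].
  set (o := clen (compile f [0] 1)) in *.
  assert (L : forall d, fst (steps (halt_on_zero f) (S d + k) (start m)) = o + 1).
  { intros d. rewrite steps_add, Hk. unfold steps. induction d as [|d IH].
    - simpl Nat.iter. unfold step, o. now rewrite halt_on_zero_test.
    - rewrite Nat.iter_succ. destruct Nat.iter as [pc s]. simpl in IH. subst pc.
      unfold step, o. now rewrite halt_on_zero_loop. }
  (* A run halted after [j] steps stays where it is, yet at time [S j + k] the counter is [o + 1],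
     an address inside the program. *)
  specialize (L j). replace (S j + k) with (1 + k + j) in L by lia.
  rewrite steps_add, steps_halted in L by auto.
  unfold halted in Hj. rewrite L in Hj. unfold o in Hj. now rewrite halt_on_zero_loop in Hj.
Qed.

(** * Programs computing codes *)

Fixpoint prf_const (n : nat) : prf :=
  match n with
  | 0 => PZero
  | S n => PComp PSucc [prf_const n]
  end.

Definition prf_add : prf := PRec (PProj 0) (PComp PSucc [PProj 1]).

Definition prf_triangle : prf :=
  PRec PZero (PComp prf_add [PComp PSucc [PProj 0]; PProj 1]).

Definition prf_cpair : prf :=
  PComp prf_add [PComp prf_triangle [PComp prf_add [PProj 0; PProj 1]]; PProj 1].

Lemma eval_comp1 (f g : prf) (v : list nat) (a y : nat) :
  eval g v a -> eval f [a] y -> eval (PComp f [g]) v y.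
Proof. intros. econstructor; eauto. repeat constructor; auto. Qed.

Lemma eval_comp2 (f g h : prf) (v : list nat) (a b y : nat) :
  eval g v a -> eval h v b -> eval f [a; b] y -> eval (PComp f [g; h]) v y.
Proof. intros. econstructor; eauto. repeat constructor; auto. Qed.

Lemma eval_const (n : nat) (v : list nat) : eval (prf_const n) v n.
Proof. induction n; simpl. constructor. eapply eval_comp1; eauto. apply (ev_succ [n]). Qed.

Lemma eval_proj (i : nat) (v : list nat) (y : nat) : nth i v 0 = y -> eval (PProj i) v y.
Proof. intros <-. constructor. Qed.

Lemma eval_add (a b : nat) : eval prf_add [a; b] (a + b).
Proof.
  induction a; simpl.
  - apply ev_rec0. now apply eval_proj.
  - eapply ev_recS; eauto. eapply eval_comp1. now apply eval_proj. apply (ev_succ [a + b]).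
Qed.

Lemma eval_triangle (n : nat) : eval prf_triangle [n] (n * (n + 1) / 2).
Proof.
  induction n as [|n IH].
  - apply ev_rec0. constructor.
  - eapply ev_recS; eauto. replace (S n * (S n + 1) / 2) with (S n + n * (n + 1) / 2).
    + eapply eval_comp2; [|now apply eval_proj|apply eval_add].
      eapply eval_comp1. now apply eval_proj. apply (ev_succ [n]).
    + replace (S n * (S n + 1)) with (n * (n + 1) + S n * 2) by lia.
      rewrite Nat.div_add by lia. lia.
Qed.

Lemma eval_cpair (a b : nat) : eval prf_cpair [a; b] (cpair a b).
Proof.
  eapply eval_comp2; [|now apply eval_proj|apply eval_add].
  eapply eval_comp1; [|apply eval_triangle].
  eapply eval_comp2; [now apply eval_proj|now apply eval_proj|apply eval_add].
Qed.

(** * The formula of a machine *)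

Definition t_true : lrcT := T_EqX 0 0 0.
Definition t_or (a b : lrcT) : lrcT := T_Not (T_And (T_Not a) (T_Not b)).
Definition t_imp (a b : lrcT) : lrcT := T_Not (T_And a (T_Not b)).
Definition t_eventually (a : lrcT) : lrcT := T_Until t_true a.
Definition t_always (a : lrcT) : lrcT := T_Not (t_eventually (T_Not a)).
Definition t_conj (l : list lrcT) : lrcT := fold_right T_And t_true l.

Section Connectives.
Context {D : Type} (lt : D -> D -> Prop) (s : model D).

Lemma sat_or (i : nat) (a b : lrcT) :
  satT lt s i (t_or a b) <-> satT lt s i a \/ satT lt s i b.
Proof. simpl. split; [intros H; apply NNPP|]; tauto. Qed.

Lemma sat_imp (i : nat) (a b : lrcT) :
  satT lt s i (t_imp a b) <-> (satT lt s i a -> satT lt s i b).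
Proof. simpl. split; [intros H ?; apply NNPP|]; tauto. Qed.

Lemma sat_eventually (i : nat) (a : lrcT) :
  satT lt s i (t_eventually a) <-> exists j, i <= j /\ satT lt s j a.
Proof.
  simpl. split.
  - intros (j & Hj & H & _). eauto.
  - intros (j & Hj & H). exists j. repeat split; auto.
Qed.

Lemma sat_always (i : nat) (a : lrcT) :
  satT lt s i (t_always a) <-> forall j, i <= j -> satT lt s j a.
Proof.
  change (satT lt s i (t_always a)) with (~ satT lt s i (t_eventually (T_Not a))).
  rewrite sat_eventually. simpl. split.
  - intros H j Hj. apply NNPP. eauto.
  - intros H (j & Hj & Hn). auto.
Qed.

Lemma sat_conj (i : nat) (l : list lrcT) :
  satT lt s i (t_conj l) <-> forall a, In a l -> satT lt s i a.
Proof.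
  induction l as [|b l IH]; simpl.
  - split; [tauto|]. intros _. now rewrite Nat.add_0_r.
  - fold (t_conj l). rewrite IH. split.
    + intros [Hb H] a [<-|Ha]; auto.
    + intros H; split; auto.
Qed.

Lemma sat_conj_seq (i n : nat) (f : nat -> lrcT) :
  satT lt s i (t_conj (map f (seq 0 n))) <-> forall c, c < n -> satT lt s i (f c).
Proof.
  rewrite sat_conj. split.
  - intros H c Hc. apply H, in_map, in_seq. lia.
  - intros H a Ha. apply in_map_iff in Ha as (c & <- & Hc). apply in_seq in Hc. apply H. lia.
Qed.

End Connectives.

(* Variable 0 is a constant, the least value, variable 1 a clock. Variable
   2 (resp. [at_var q]) agrees with variable 0 while the input is loaded (resp.
   when the program counter is [q]). Register [c] is a queue: [enq_var c] holds
   the clock value enqueued by an increment, [deq_var c] the last one dequeued. *)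
Definition at_var (q : nat) : var := 3 + 3 * q.
Definition enq_var (c : nat) : var := 4 + 3 * c.
Definition deq_var (c : nat) : var := 5 + 3 * c.

Definition loading : lrcT := T_EqX 2 0 0.
Definition at_pc (q : nat) : lrcT := T_EqX (at_var q) 0 0.

Inductive op : Type := OInc | ODec | OZero | ONone.

(** The effect on queue [c] between a time and the next. An increment enqueues the next clock value
    and promises that it will be dequeued. The other operations enqueue the constant, which is never
    above a dequeued value and so does not count as an element. *)
Definition op_form (o : op) (c : nat) : lrcT :=
  match o with
  | OInc => T_And (T_EqX (enq_var c) 1 1)
              (T_And (T_EqX (deq_var c) 1 (deq_var c)) (T_EqXF (enq_var c) (deq_var c)))
  | ODec => T_And (T_EqX (enq_var c) 0 0)
              (T_And (T_Not (T_EqX (deq_var c) 1 (deq_var c)))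
                 (T_Next (T_EqXFi (deq_var c) (enq_var c))))
  | OZero => T_And (T_EqX (enq_var c) 0 0) (T_Next (T_EqX (deq_var c) 0 1))
  | ONone => T_And (T_EqX (enq_var c) 0 0) (T_EqX (deq_var c) 1 (deq_var c))
  end.

Definition only (o : op) (r c : nat) : op := if c =? r then o else ONone.

Definition ops_form (R : nat) (o : op) (r : nat) : lrcT :=
  t_conj (map (fun c => op_form (only o r c) c) (seq 0 R)).

Definition ticking : lrcT := T_Not (T_EqX 1 1 1).

(** [DEC] leaves both branches open; the queue decides, since [OZero] is possible only when it is
    empty and [ODec] only when it is not. *)
Definition instr_form (R : nat) (ins : instr) : lrcT :=
  T_And ticking
    match ins with
    | INC r l => T_And (ops_form R OInc r) (T_Next (at_pc l))
    | DEC r lz ln =>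
        t_or (T_And (ops_form R OZero r) (T_Next (at_pc lz)))
             (T_And (ops_form R ODec r) (T_Next (at_pc ln)))
    end.

Definition instr_reg (ins : instr) : nat := match ins with INC r _ | DEC r _ _ => r end.

Definition reg_bound (P : list instr) : nat := S (list_max (map instr_reg P)).

Definition initial_form (R : nat) : lrcT :=
  T_And (T_EqX 1 0 0) (t_conj (map (fun c => T_EqX (deq_var c) 0 0) (seq 0 R))).

Definition monotone_form (R : nat) : lrcT :=
  T_And (T_EqX 0 1 0)
    (T_And (T_Not (T_GtXF 1 1))
       (t_conj (map (fun c => T_Not (T_GtXF (deq_var c) (deq_var c))) (seq 0 R)))).

Definition control_form (P : list instr) (R q : nat) : lrcT :=
  match nth_error P q with
  | Some ins => t_imp (at_pc q) (instr_form R ins)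
  | None => t_true
  end.

(** Loading steps and instructions make the clock tick, so a clock that stops at some time, as the
    last conjunct demands, witnesses halting. The input does not occur here. *)
Definition machine_form (P : list instr) : lrcT :=
  let R := reg_bound P in
  t_conj
    [initial_form R;
     t_always (monotone_form R);
     t_always (t_imp loading (T_And ticking (ops_form R OInc 0)));
     t_always (t_conj (map (control_form P R) (seq 0 (length P))));
     t_eventually (T_EqX 1 1 1)].

(** Each of the [m] loading steps increments register 0. The nesting makes the code of the formula a
    primitive recursion on [m]. *)
Fixpoint input_form (m : nat) : lrcT :=
  match m with
  | 0 => at_pc 0
  | S m => T_And loading (T_Next (input_form m))
  end.

Lemma sat_input (D : Type) (lt : D -> D -> Prop) (s : model D) (m i : nat) :
  satT lt s i (input_form m) <->
  (forall j, j < m -> satT lt s (i + j) loading) /\ satT lt s (i + m) (at_pc 0).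
Proof.
  revert i. induction m as [|m IH]; intros i.
  - rewrite Nat.add_0_r. simpl. split; [|tauto]. intros H. split; auto. lia.
  - change (satT lt s i (input_form (S m)))
      with (satT lt s i loading /\ satT lt s (S i) (input_form m)).
    rewrite IH, <- Nat.add_succ_comm. split.
    + intros (H0 & H1 & H2). split; auto. intros [|j] Hj.
      * now rewrite Nat.add_0_r.
      * rewrite <- Nat.add_succ_comm. apply H1. lia.
    + intros (H1 & H2). repeat split; auto.
      * specialize (H1 0). rewrite Nat.add_0_r in H1. apply H1. lia.
      * intros j Hj. rewrite Nat.add_succ_comm. apply H1. lia.
Qed.

(** * Soundness *)

Section QueueInvariant.
Context {D : Type} (lt : D -> D -> Prop) (Hlt : strict_total_order lt).
Variables (T A B Z : nat -> D).
Hypothesis Z_const : forall i, Z i = Z (i + 1).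
Hypothesis T_mono : forall i j, i < j -> ~ lt (T j) (T i).
Hypothesis B_mono : forall i j, i < j -> ~ lt (B j) (B i).
Hypothesis T_zero : T 0 = Z 0.
Hypothesis B_zero : B 0 = Z 0.

(** [T] is the clock, [A] the enqueued value, [B] the last dequeued one, [Z] the constant. The
    elements at time [i] are the past enqueued values above [B i]. The last clause, together with
    the monotonicity of [B], says that each of them is dequeued after time [i]. *)
Definition queue (i n : nat) : Prop :=
  ~ lt (T i) (B i) /\
  (forall j, j < i -> ~ lt (T i) (A j)) /\
  exists Q, StronglySorted lt Q /\ length Q = n /\
    (forall x, In x Q <-> (exists j, j < i /\ A j = x) /\ lt (B i) x) /\
    (forall x, In x Q -> exists j, B j = x).

Definition op_sem (o : op) (i : nat) : Prop :=
  match o with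
  | OInc => A i = T (i + 1) /\ B i = B (i + 1) /\ exists j, i < j /\ A i = B j
  | ODec => A i = Z i /\ B i <> B (i + 1) /\ exists j, j < i + 1 /\ B (i + 1) = A j
  | OZero => A i = Z i /\ B (i + 1) = T (i + 1)
  | ONone => A i = Z i /\ B i = B (i + 1)
  end.

(** A relation, because [ODec] is blocked at 0 and [OZero] at a positive value. *)
Definition op_step (o : op) (x y : nat) : Prop :=
  match o with
  | OInc => y = S x
  | ODec => x = S y
  | OZero => x = 0 /\ y = 0
  | ONone => y = x
  end.

Lemma nlt_trans (x y z : D) : ~ lt y x -> ~ lt z y -> ~ lt z x.
Proof.
  destruct Hlt as (irr & tr & tot). intros H1 H2 H3.
  destruct (classic (y = z)) as [->|Hn]; [tauto|].
  destruct (tot _ _ Hn); eauto.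
Qed.

Lemma nlt_lt_trans (x y z : D) : ~ lt y x -> lt y z -> lt x z.
Proof.
  destruct Hlt as (irr & tr & tot). intros H1 H2.
  destruct (classic (x = y)) as [->|Hn]; auto.
  destruct (tot _ _ Hn); eauto. tauto.
Qed.

Lemma nlt_neq_lt (x y : D) : ~ lt y x -> x <> y -> lt x y.
Proof. destruct Hlt as (irr & tr & tot). intros H1 H2. destruct (tot _ _ H2); tauto. Qed.

Lemma mono_le (F : nat -> D) (i j : nat) :
  (forall i j, i < j -> ~ lt (F j) (F i)) -> i <= j -> ~ lt (F j) (F i).
Proof.
  intros H Hij. destruct (Nat.eq_dec i j) as [<-|]; [apply Hlt|apply H; lia].
Qed.

Lemma Z_eq (i : nat) : Z i = Z 0.
Proof. induction i as [|i IH]; auto. now rewrite <- IH, (Z_const i), Nat.add_1_r. Qed.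

Lemma queue_init : queue 0 0.
Proof.
  split; [|split].
  - rewrite T_zero, B_zero. apply Hlt.
  - lia.
  - exists []. repeat split; try constructor; simpl; try tauto.
    intros [(j & Hj & _) _]. lia.
Qed.

(** [B] starts at the constant and never decreases, so enqueueing the constant adds no element. *)
Lemma lt_B_not_Z (i j : nat) : A j = Z j -> ~ lt (B i) (A j).
Proof. intros ->. rewrite Z_eq, <- B_zero. apply mono_le; auto. lia. Qed.

Lemma StronglySorted_snoc (Q : list D) (x : D) :
  StronglySorted lt Q -> (forall y, In y Q -> lt y x) -> StronglySorted lt (Q ++ [x]).
Proof.
  induction 1 as [|y Q HQ IH Hy]; simpl; intros H; constructor; auto.
  - constructor.
  - apply Forall_app. split; auto.
Qed.

(** The core of soundness. The clock strictly increases, so a new element goes to the end of the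
    queue. The pointer [B] never decreases and must visit every element, so it can neither skip the
    head nor jump to the clock over a nonempty queue. *)
Lemma queue_step (o : op) (i n : nat) :
  T i <> T (i + 1) -> op_sem o i -> queue i n -> exists n', op_step o n n' /\ queue (i + 1) n'.
Proof.
  destruct (Hlt) as (irr & tr & tot).
  intros HT Ho (HB & HA & Q & HQ & Hlen & Hin & HhB).
  assert (Hle : ~ lt (T (i + 1)) (T i)) by (apply T_mono; lia).
  assert (Hti : lt (T i) (T (i + 1))) by (apply nlt_neq_lt; auto).
  assert (HA' : forall j, j < i -> ~ lt (T (i + 1)) (A j)).
  { intros j Hj. apply nlt_trans with (T i); auto. }
  assert (HAi : A i = Z i -> forall j, j < i + 1 -> ~ lt (T (i + 1)) (A j)).
  { intros E j Hj. destruct (Nat.eq_dec j i) as [->|]; [|apply HA'; lia].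
    rewrite E, Z_eq, <- T_zero. apply T_mono. lia. }
  assert (HBi : B i = B (i + 1) -> ~ lt (T (i + 1)) (B (i + 1))).
  { intros <-. apply nlt_trans with (T i); auto. }
  assert (HQT : forall x, In x Q -> lt x (T (i + 1))).
  { intros x Hx. apply Hin in Hx as [(j & Hj & <-) _]. apply nlt_lt_trans with (T i); auto. }
  destruct o; simpl in Ho |- *.
  - destruct Ho as (EA & EB & k & Hk & EAB). exists (S n). split; auto. split; [|split]; auto.
    { intros j Hj. destruct (Nat.eq_dec j i) as [->|]; [|apply HA'; lia].
      rewrite EA. apply irr. }
    exists (Q ++ [T (i + 1)]). split; [|split; [|split]].
    + apply StronglySorted_snoc; auto.
    + rewrite length_app. simpl. lia.
    + intros x. rewrite in_app_iff, Hin, <- EB. simpl. split.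
      * intros [[(j & Hj & E) H]|[<-|[]]].
        -- split; auto. exists j. split; auto. lia.
        -- split. exists i. split; auto. lia. apply nlt_lt_trans with (T i); auto.
      * intros [(j & Hj & E) H]. destruct (Nat.eq_dec j i) as [->|].
        -- right. left. congruence.
        -- left. split; auto. exists j. split; auto. lia.
    + intros x Hx. apply in_app_iff in Hx as [Hx|[<-|[]]]; auto.
      exists k. congruence.
  - destruct Ho as (EA & EB & k & Hk & EBA).
    assert (Hb : lt (B i) (B (i + 1))) by (apply nlt_neq_lt; auto; apply B_mono; lia).
    (* The new dequeued value was enqueued before time [i]: at time [i] itself only the constant is
       enqueued. *)
    assert (HbQ : In (B (i + 1)) Q).
    { apply Hin. split; auto. exists k. split; auto.
      destruct (Nat.eq_dec k i) as [->|]; [|lia].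
      rewrite EBA in Hb. now apply lt_B_not_Z in Hb. }
    destruct Q as [|y Q]; [destruct HbQ|]. inversion HQ as [|? ? HQ' Hy]; subst.
    rewrite Forall_forall in Hy.
    (* Otherwise the head [y] lies strictly between [B i] and [B (i + 1)], so that the monotone [B]
       could never take the value [y]. *)
    assert (E : B (i + 1) = y).
    { destruct HbQ as [|HbQ]; auto. apply Hy in HbQ. exfalso.
      destruct (HhB y) as [j Hj]; [simpl; auto|].
      assert (Hyi : lt (B i) y) by (apply Hin; simpl; auto). subst y.
      destruct (Nat.le_gt_cases j i) as [H|H].
      - revert Hyi. apply mono_le; auto.
      - revert HbQ. apply mono_le; auto. lia. }
    exists (length Q). split; auto. split; [|split]; auto.
    { rewrite EBA. auto. }
    exists Q. split; [|split; [|split]]; auto.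
    + intros x. split.
      * intros Hx. split; [|rewrite E; auto].
        assert (H : In x (y :: Q)) by (simpl; auto). apply Hin in H as [(j & Hj & Ej) _].
        exists j. split; auto. lia.
      * intros [(j & Hj & Ej) H]. destruct (Nat.eq_dec j i) as [->|].
        { exfalso. revert H. rewrite <- Ej. apply lt_B_not_Z; auto. }
        assert (Hx : In x (y :: Q)).
        { apply Hin. split. exists j. split; auto. lia. eauto. }
        destruct Hx as [<-|]; auto. rewrite E in H. now apply irr in H.
    + intros x Hx. apply HhB. simpl; auto.
  - destruct Ho as (EA & EB). exists 0.
    (* A head [y] exceeds [B i], so [B] takes the value [y] only after time [i], when it is already
       at least [T (i + 1)]; but [y] is below [T (i + 1)]. *)
    assert (Q = []).
    { destruct Q as [|y Q]; auto. exfalso.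
      assert (Hy : In y (y :: Q)) by (simpl; auto).
      specialize (HQT _ Hy). destruct (HhB _ Hy) as [j <-]. apply Hin in Hy as [_ Hy].
      destruct (Nat.le_gt_cases j i) as [H|H].
      - revert Hy. apply mono_le; auto.
      - rewrite <- EB in HQT. revert HQT. apply mono_le; auto. lia. }
    subst. split; auto. split; [|split]; auto.
    { rewrite EB. apply irr. }
    exists []. repeat split; auto; simpl; try tauto.
    intros [(j & Hj & <-) H]. rewrite EB in H. revert H. apply HAi; auto.
  - destruct Ho as (EA & EB). exists n. split; auto. split; [|split]; auto.
    exists Q. split; [|split; [|split]]; auto.
    intros x. rewrite Hin, <- EB. split; intros [(j & Hj & E) H]; split; auto.
    + exists j. split; auto. lia.
    + destruct (Nat.eq_dec j i) as [->|].
      * exfalso. revert H. rewrite <- E. apply lt_B_not_Z; auto.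
      * exists j. split; auto. lia.
Qed.

End QueueInvariant.

(** * From a model of the formula to the run of the machine *)

Lemma sat_eq_now {D : Type} (lt : D -> D -> Prop) (s : model D) (i : nat) (x y : var) :
  satT lt s i (T_EqX x 0 y) <-> s i x = s i y.
Proof. simpl. now rewrite Nat.add_0_r. Qed.

Lemma sat_op {D : Type} (lt : D -> D -> Prop) (s : model D) (i : nat) (o : op) (c : nat) :
  satT lt s i (op_form o c) <->
  op_sem (fun i => s i 1) (fun i => s i (enq_var c)) (fun i => s i (deq_var c))
    (fun i => s i 0) o i.
Proof. destruct o; simpl; rewrite ?Nat.add_0_r, ?Nat.add_1_r; tauto. Qed.

Lemma instr_reg_bound (P : list instr) (q : nat) (ins : instr) :
  nth_error P q = Some ins -> instr_reg ins < reg_bound P.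
Proof.
  intros H. apply nth_error_In in H. unfold reg_bound.
  assert (L := list_max_le (map instr_reg P) (list_max (map instr_reg P))).
  destruct L as [L _]. specialize (L (le_n _)). rewrite Forall_forall in L.
  specialize (L (instr_reg ins) (in_map _ _ _ H)). lia.
Qed.

Lemma op_step_inc (x : nat -> nat) (r c n : nat) :
  op_step (only OInc r c) (x c) n -> n = upd x r (S (x r)) c.
Proof.
  unfold only, upd. destruct (Nat.eqb_spec c r), (Nat.eq_dec c r); subst; simpl; congruence.
Qed.

Lemma op_step_dec (x : nat -> nat) (r c n : nat) :
  op_step (only ODec r c) (x c) n -> n = upd x r (pred (x r)) c.
Proof.
  unfold only, upd. destruct (Nat.eqb_spec c r), (Nat.eq_dec c r); subst; simpl; try congruence.
  now intros ->.
Qed.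

Lemma op_step_zero (x : nat -> nat) (r c n : nat) :
  op_step (only OZero r c) (x c) n -> n = x c.
Proof. unfold only. destruct (Nat.eqb_spec c r); simpl; lia. Qed.

Section Soundness.
Context {D : Type} (lt : D -> D -> Prop) (Hlt : strict_total_order lt).
Variables (s : model D) (P : list instr) (m : nat).
Let R := reg_bound P.
Hypothesis Hform : satT lt s 0 (machine_form P).
Hypothesis Hinput : satT lt s 0 (input_form m).

Let queues (i : nat) (x : nat -> nat) : Prop := forall c, c < R ->
  queue lt (fun i => s i 1) (fun i => s i (enq_var c)) (fun i => s i (deq_var c)) i (x c).

Lemma sat_parts :
  (s 0 1 = s 0 0 /\ forall c, c < R -> s 0 (deq_var c) = s 0 0) /\
  (forall i, s i 0 = s (i + 1) 0 /\ (forall j, i < j -> ~ lt (s j 1) (s i 1)) /\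
     forall c, c < R -> forall j, i < j -> ~ lt (s j (deq_var c)) (s i (deq_var c))) /\
  (forall i, satT lt s i loading -> satT lt s i ticking /\ satT lt s i (ops_form R OInc 0)) /\
  (forall i q ins, nth_error P q = Some ins -> satT lt s i (at_pc q) ->
     satT lt s i (instr_form R ins)) /\
  (exists j, ~ satT lt s j ticking).
Proof.
  unfold machine_form in Hform. rewrite sat_conj in Hform. fold R in Hform. simpl In in Hform.
  split; [|split; [|split; [|split]]].
  - assert (H : satT lt s 0 (initial_form R)) by auto. destruct H as [H1 H2].
    rewrite sat_conj_seq in H2. split; auto.
  - assert (H : satT lt s 0 (t_always (monotone_form R))) by auto.
    rewrite sat_always in H. intros i. destruct (H i) as (H1 & H2 & H3); [lia|].
    rewrite sat_conj_seq in H3. simpl in H2. repeat split; auto.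
    + intros j Hj Hc. apply H2. eauto.
    + intros c Hc j Hj Hl. apply (H3 c Hc). simpl. eauto.
  - assert (H : satT lt s 0 (t_always (t_imp loading (T_And ticking (ops_form R OInc 0)))))
      by (apply Hform; tauto).
    rewrite sat_always in H. intros i. specialize (H i). rewrite sat_imp in H.
    apply H. lia.
  - assert (H : satT lt s 0 (t_always (t_conj (map (control_form P R) (seq 0 (length P))))))
      by (apply Hform; tauto).
    rewrite sat_always in H. intros i q ins Hq Hat. specialize (H i (Nat.le_0_l _)).
    rewrite sat_conj_seq in H. specialize (H q). unfold control_form in H. rewrite Hq in H.
    rewrite sat_imp in H. apply H; auto. apply nth_error_Some. congruence.
  - assert (H : satT lt s 0 (t_eventually (T_EqX 1 1 1))) by (apply Hform; tauto).
    rewrite sat_eventually in H. destruct H as (j & _ & H). exists j. simpl in *. tauto.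
Qed.

Lemma queues_step (i : nat) (x : nat -> nat) (o : op) (r : nat) :
  satT lt s i ticking -> satT lt s i (ops_form R o r) -> queues i x ->
  forall c, c < R -> exists n, op_step (only o r c) (x c) n /\
    queue lt (fun i => s i 1) (fun i => s i (enq_var c)) (fun i => s i (deq_var c)) (i + 1) n.
Proof.
  destruct sat_parts as ((I1 & I2) & M & _). intros Ht Ho Hq c Hc.
  unfold ops_form in Ho. rewrite sat_conj_seq in Ho. specialize (Ho c Hc).
  rewrite sat_op in Ho. apply (queue_step lt Hlt (fun i => s i 1) (fun i => s i (enq_var c))
    (fun i => s i (deq_var c)) (fun i => s i 0)); auto; simpl.
  - intros j. apply M.
  - intros j j'. apply M.
  - intros j j'. now apply M.
Qed.

Lemma queues_load (i : nat) : i <= m -> queues i (upd (fun _ => 0) 0 i).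
Proof.
  destruct sat_parts as ((I1 & I2) & M & L & _).
  induction i as [|i IH]; intros Hi.
  - intros c Hc. replace (upd _ 0 0 c) with 0.
    + eapply queue_init with (Z := fun i => s i 0); auto.
    + unfold upd. now destruct Nat.eq_dec.
  - apply sat_input in Hinput as [Hl _]. destruct (L i) as [L1 L2]; [apply Hl; lia|].
    intros c Hc. destruct (queues_step i _ _ _ L1 L2 (IH ltac:(lia)) c Hc) as (n & Hn & Hq).
    rewrite <- (Nat.add_1_r i) at 1. replace (upd _ 0 (S i) c) with n; auto.
    apply op_step_inc in Hn. subst n. unfold upd. simpl.
    destruct Nat.eq_dec; auto.
Qed.

(** If the program never halts, the model follows its whole run from time [m] on. Every time is then
    a loading step or an instruction, so the clock always ticks, against the last conjunct. *)
Lemma machine_form_sound : halts P m.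
Proof.
  destruct sat_parts as (_ & _ & L & C & j & Hj).
  apply NNPP. intros Hnot.
  assert (Hrun : forall k, satT lt s (m + k) (at_pc (fst (steps P k (start m)))) /\
                           queues (m + k) (snd (steps P k (start m)))).
  { induction k as [|k [IH1 IH2]].
    - rewrite Nat.add_0_r. split; [|apply queues_load; auto].
      now apply sat_input in Hinput as [_ Hl].
    - assert (Hk : ~ halted P (steps P k (start m))) by (intros H; apply Hnot; now exists k).
      change (steps P (S k) (start m)) with (step P (steps P k (start m))).
      destruct (steps P k (start m)) as [pc x]. unfold halted in Hk. simpl in *.
      destruct (nth_error P pc) as [ins|] eqn:E; [|tauto].
      assert (Hr := instr_reg_bound _ _ _ E).
      destruct (C _ _ _ E IH1) as [Ht Hi].
      replace (m + S k) with (S (m + k)) by lia.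
      assert (St : forall o r y, satT lt s (m + k) (ops_form R o r) ->
        (forall c n, c < R -> op_step (only o r c) (x c) n -> n = y c) -> queues (S (m + k)) y).
      { intros o r y Ho Hy c Hc.
        destruct (queues_step _ _ _ _ Ht Ho IH2 c Hc) as (n & Hn & Hq).
        rewrite Nat.add_1_r in Hq. rewrite <- (Hy c n); auto. }
      destruct ins as [r l|r lz ln].
      + destruct Hi as [Ho Hl]. split; auto. simpl.
        eapply St; eauto. intros. now apply op_step_inc.
      + rewrite sat_or in Hi. simpl in Hr.
        (* The branch chosen by the model must be possible for the tracked content of register [r],
           which makes it the branch taken by [step]. *)
        assert (Hop : forall o, satT lt s (m + k) (ops_form R o r) -> exists n, op_step o (x r) n).
        { intros o Ho. destruct (queues_step _ _ _ _ Ht Ho IH2 r Hr) as (n & Hn & _).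
          unfold only in Hn. rewrite Nat.eqb_refl in Hn. eauto. }
        destruct Hi as [[Ho Hl]|[Ho Hl]]; destruct (Hop _ Ho) as [n Hn]; simpl in Hn.
        * replace (x r =? 0) with true by (symmetry; now apply Nat.eqb_eq). split; auto. simpl.
          eapply St; eauto. intros. eapply op_step_zero; eauto.
        * replace (x r =? 0) with false by (symmetry; apply Nat.eqb_neq; lia). split; auto. simpl.
          eapply St; eauto. intros. now apply op_step_dec. }
  apply Hj. destruct (Nat.le_gt_cases m j) as [H|H].
  - replace j with (m + (j - m)) by lia. destruct (Hrun (j - m)) as [H1 _].
    destruct (nth_error P (fst (steps P (j - m) (start m)))) as [ins|] eqn:E.
    + apply (C _ _ _ E H1).
    + exfalso. apply Hnot. now exists (j - m).
  - apply L. apply sat_input in Hinput as [Hl _]. now apply Hl.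
Qed.

End Soundness.

(** * Completeness *)

Section Schedule.
Variables (o : nat -> op) (x : nat -> nat) (N : nat).
Hypothesis Hx0 : x 0 = 0.
Hypothesis Hx : forall i, i < N -> op_step (o i) (x i) (x (S i)).

(* The queue and the last dequeued value at time [i], as clock times. *)
Fixpoint schedule (i : nat) : list nat * nat :=
  match i with
  | 0 => ([], 0)
  | S i =>
      let (Q, b) := schedule i in
      match o i with
      | OInc => (Q ++ [S i], b)
      | ODec => match Q with [] => (Q, b) | y :: Q => (Q, y) end
      | OZero => (Q, S i)
      | ONone => (Q, b)
      end
  end.

(* After time [N] the pointer sweeps the whole clock, so that the elements still
   queued are dequeued. *)
Definition dequeued (i : nat) : nat :=
  if i <=? N then snd (schedule i) else Nat.max (snd (schedule N)) (Nat.min (i - S N) N).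

(** The last clause accounts for every enqueued value: it is still queued or has been the last
    dequeued one at some time. [dequeued_all] rests on it. *)
Lemma schedule_inv (i : nat) : i <= N ->
  let (Q, b) := schedule i in
  length Q = x i /\ StronglySorted Nat.lt Q /\ b <= i /\
  (forall y, In y Q -> b < y /\ exists j, y = S j /\ j < i /\ o j = OInc) /\
  (forall j, j < i -> o j = OInc ->
     In (S j) Q \/ exists k, j < k /\ k <= i /\ snd (schedule k) = S j).
Proof.
  induction i as [|i IH]; intros Hi.
  - simpl. repeat split; auto; try constructor; try tauto; lia.
  - specialize (IH ltac:(lia)). specialize (Hx i Hi). simpl schedule at 1.
    (* The unfolded value at time [S i] is kept for the decrement case, where [S i] is the time at
       which the head is dequeued. *)
    assert (Hsnd := eq_refl (snd (schedule (S i)))). simpl schedule at 2 in Hsnd.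
    destruct (schedule i) as [Q b] eqn:EQ.
    destruct IH as (Hlen & Hs & Hb & HQ & HI).
    destruct (o i) eqn:Eo; simpl in Hx.
    + split; [rewrite length_app; simpl; lia|]. split.
      { apply StronglySorted_snoc; auto. intros y Hy. destruct (HQ y Hy) as (_ & j & -> & Hj & _).
        unfold Nat.lt. lia. }
      split; [lia|]. split.
      * intros y Hy. apply in_app_iff in Hy as [Hy|[<-|[]]].
        -- destruct (HQ y Hy) as (H1 & j & -> & Hj & H2). split; auto. exists j. auto.
        -- split. lia. exists i. auto.
      * intros j Hj Ej. rewrite in_app_iff. destruct (Nat.eq_dec j i) as [->|].
        -- left. right. simpl. auto.
        -- destruct (HI j) as [H|(k & H1 & H2 & H3)]; auto. lia. right. exists k. auto.
    + destruct Q as [|y Q]; [simpl in Hlen; lia|].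
      inversion Hs as [|? ? Hs' Hy]; subst. rewrite Forall_forall in Hy.
      assert (HyQ := HQ y (or_introl eq_refl)).
      split; [simpl in Hlen; lia|]. split; auto. split.
      { destruct HyQ as (_ & j & -> & Hj & _). lia. } split.
      * intros z Hz. destruct (HQ z) as (_ & j & -> & Hj & H2); [simpl; auto|].
        split. apply Hy, Hz. exists j. auto.
      * intros j Hj Ej. destruct (Nat.eq_dec j i) as [->|]; [congruence|].
        destruct (HI j) as [[<-|H]|(k & H1 & H2 & H3)]; auto; try lia.
        -- right. exists (S i). repeat split; auto; lia.
        -- right. exists k. auto.
    + destruct Hx as [E1 E2]. rewrite E1 in Hlen. destruct Q as [|y Q]; [|discriminate].
      split; [simpl; lia|]. split; auto. split; auto. split; [simpl; tauto|].
      intros j Hj Ej. destruct (Nat.eq_dec j i) as [->|]; [congruence|].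
      destruct (HI j) as [[]|(k & H1 & H2 & H3)]; auto; try lia. right. exists k. auto.
    + split; [lia|]. split; auto. split; [lia|]. split.
      * intros y Hy. destruct (HQ y Hy) as (H1 & j & -> & Hj & H2). split; auto. exists j. auto.
      * intros j Hj Ej. destruct (Nat.eq_dec j i) as [->|]; [congruence|].
        destruct (HI j) as [H|(k & H1 & H2 & H3)]; auto; try lia. right. exists k. auto.
Qed.

Lemma dequeued_zero : dequeued 0 = 0.
Proof. reflexivity. Qed.

Lemma dequeued_bound (i : nat) : dequeued i <= N.
Proof.
  unfold dequeued. destruct (Nat.leb_spec i N) as [H|H].
  - assert (I := schedule_inv i H). destruct schedule as [Q b]. simpl. lia.
  - assert (I := schedule_inv N (le_n _)). destruct schedule as [Q b]. simpl. lia.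
Qed.

Lemma dequeued_step (i : nat) : i < N ->
  match o i with
  | OInc | ONone => dequeued (S i) = dequeued i
  | ODec => dequeued i < dequeued (S i) /\ exists j, j < i /\ o j = OInc /\ dequeued (S i) = S j
  | OZero => dequeued (S i) = S i
  end.
Proof.
  intros H. unfold dequeued. destruct (Nat.leb_spec i N), (Nat.leb_spec (S i) N); try lia.
  assert (I := schedule_inv i ltac:(lia)). specialize (Hx i H). simpl schedule.
  destruct (schedule i) as [Q b]. destruct I as (Hlen & _ & _ & HQ & _).
  destruct (o i); auto. destruct Q as [|y Q]; simpl in Hx, Hlen; [lia|].
  destruct (HQ y) as (H2 & j & -> & Hj & Ej); simpl; eauto.
Qed.

Lemma dequeued_mono (i j : nat) : i <= j -> dequeued i <= dequeued j.
Proof.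
  induction 1 as [|j Hj IH]; auto. etransitivity; [exact IH|]. clear IH.
  destruct (Nat.lt_trichotomy j N) as [H|[->|H]].
  - assert (St := dequeued_step j H). destruct (o j); try lia.
    rewrite St. unfold dequeued. destruct (Nat.leb_spec j N); [|lia].
    assert (I := schedule_inv j ltac:(lia)). destruct schedule as [Q b]. simpl. lia.
  - unfold dequeued. destruct (Nat.leb_spec N N), (Nat.leb_spec (S N) N); lia.
  - unfold dequeued. destruct (Nat.leb_spec j N), (Nat.leb_spec (S j) N); lia.
Qed.

Lemma dequeued_all (i : nat) : i < N -> o i = OInc -> exists j, i < j /\ dequeued j = S i.
Proof.
  intros Hi Ei. assert (I := schedule_inv N (le_n _)).
  destruct (schedule N) as [Q b] eqn:E. destruct I as (_ & _ & _ & HQ & HI).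
  destruct (HI i Hi Ei) as [H|(k & H1 & H2 & H3)].
  (* The sweep passes [S i] at this time, and the maximum is [S i], since a value still queued
     exceeds the last dequeued one. *)
  - exists (S N + S i). split; [lia|]. unfold dequeued.
    destruct (Nat.leb_spec (S N + S i) N); [lia|]. rewrite E. simpl snd.
    apply HQ in H as [H _]. lia.
  - exists k. split; auto. unfold dequeued. destruct (Nat.leb_spec k N); auto. lia.
Qed.

End Schedule.

(** * The model of a halting run *)

Section Completeness.
Context {D : Type} (lt : D -> D -> Prop) (Hlt : strict_total_order lt).
Variables (P : list instr) (m k : nat).
Hypothesis Hhalt : halted P (steps P k (start m)).
Let N := m + k.
Variable e : nat -> D.
Hypothesis He : forall i j, i < j -> j <= S N -> lt (e i) (e j).

(** Loading counts as incrementing register 0, so that [op_at] treats both phases alike. *)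
Definition current (i : nat) : option instr :=
  if i <? m then Some (INC 0 0) else nth_error P (fst (steps P (i - m) (start m))).

Definition contents (i : nat) : nat -> nat :=
  if i <? m then upd (fun _ => 0) 0 i else snd (steps P (i - m) (start m)).

Definition op_at (c i : nat) : op :=
  match current i with
  | Some (INC r _) => only OInc r c
  | Some (DEC r _ _) => only (if contents i r =? 0 then OZero else ODec) r c
  | None => ONone
  end.

(** Positions in the chain [e]. The clock runs from 0 to [N] and stops; queue values are clock
    times. A flag is 0 when set and 1 otherwise, and the index 1 is why the chain extends to [S N],
    in case [N] is 0. *)
Definition index (i : nat) (v : var) : nat :=
  match v with
  | 0 => 0
  | 1 => Nat.min i N
  | 2 => if i <? m then 0 else 1
  | S (S (S v)) =>
      match v mod 3 with
      | 0 => if (m <=? i) && (fst (steps P (i - m) (start m)) =? v / 3) then 0 else 1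
      | 1 => match op_at (v / 3) i with OInc => if i <? N then S i else 0 | _ => 0 end
      | _ => dequeued (op_at (v / 3)) N i
      end
  end.

Definition halting_model : model D := fun i v => e (index i v).

Lemma op_at_step (c i : nat) : op_step (op_at c i) (contents i c) (contents (S i) c).
Proof.
  unfold op_at, current, contents.
  destruct (Nat.ltb_spec i m) as [H|H].
  - replace (if S i <? m then upd (fun _ => 0) 0 (S i) else snd (steps P (S i - m) (start m)))
      with (upd (fun _ => 0) 0 (S i)).
    + unfold only, upd. destruct (Nat.eqb_spec c 0), (Nat.eq_dec c 0); simpl; auto; lia.
    + destruct (Nat.ltb_spec (S i) m); auto. replace (S i - m) with 0 by lia.
      simpl. f_equal. lia.
  - destruct (Nat.ltb_spec (S i) m); [lia|]. replace (S i - m) with (S (i - m)) by lia.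
    change (steps P (S (i - m)) (start m)) with (step P (steps P (i - m) (start m))).
    destruct (steps P (i - m) (start m)) as [pc x]. simpl.
    destruct (nth_error P pc) as [[r l|r lz ln]|]; simpl; auto.
    + unfold only, upd. destruct (Nat.eqb_spec c r), (Nat.eq_dec c r); subst; simpl; auto; lia.
    + unfold only. destruct (Nat.eqb_spec (x r) 0); cbn [snd]; unfold upd;
        destruct (Nat.eqb_spec c r), (Nat.eq_dec c r); subst; cbn [op_step]; auto; lia.
Qed.

Lemma contents_zero (c : nat) : contents 0 c = 0.
Proof.
  unfold contents. destruct (Nat.ltb_spec 0 m); simpl; unfold upd; destruct Nat.eq_dec; lia.
Qed.

Lemma index_enq (c i : nat) :
  index i (enq_var c) = match op_at c i with OInc => if i <? N then S i else 0 | _ => 0 end.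
Proof.
  unfold enq_var. change (4 + 3 * c) with (S (S (S (1 + 3 * c)))). cbn [index].
  rewrite (Nat.mul_comm 3), Nat.Div0.mod_add, Nat.div_add by lia. reflexivity.
Qed.

Lemma index_deq (c i : nat) : index i (deq_var c) = dequeued (op_at c) N i.
Proof.
  unfold deq_var. change (5 + 3 * c) with (S (S (S (2 + 3 * c)))). cbn [index].
  rewrite (Nat.mul_comm 3), Nat.Div0.mod_add, Nat.div_add by lia. reflexivity.
Qed.

Lemma index_at (q i : nat) :
  index i (at_var q) =
  if (m <=? i) && (fst (steps P (i - m) (start m)) =? q) then 0 else 1.
Proof.
  unfold at_var. change (3 + 3 * q) with (S (S (S (0 + 3 * q)))). cbn [index].
  rewrite (Nat.mul_comm 3), Nat.Div0.mod_add, Nat.div_add by lia. reflexivity.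
Qed.

Lemma index_bound (i : nat) (v : var) : index i v <= S N.
Proof.
  destruct v as [|[|[|v]]]; cbn [index]; try lia.
  - destruct (i <? m); lia.
  - destruct (v mod 3) as [|[|r]].
    + destruct andb; lia.
    + destruct op_at; try lia. destruct (Nat.ltb_spec i N); lia.
    + assert (H := dequeued_bound (op_at (v / 3)) (fun i => contents i (v / 3)) N
                     (contents_zero _) (fun i _ => op_at_step _ i) i). lia.
Qed.

Lemma chain_eq (i j : nat) : i <= S N -> j <= S N -> e i = e j -> i = j.
Proof.
  destruct Hlt as (irr & _ & _). intros Hi Hj E.
  destruct (Nat.lt_trichotomy i j) as [H|[H|H]]; auto; exfalso.
  - apply (irr (e j)). rewrite <- E at 1. auto.
  - apply (irr (e j)). rewrite <- E at 2. auto.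
Qed.

Lemma chain_le (i j : nat) : i <= j -> j <= S N -> ~ lt (e j) (e i).
Proof.
  destruct Hlt as (irr & tr & _). intros Hij Hj H.
  destruct (Nat.eq_dec i j) as [->|Hn]; [now apply irr in H|].
  apply (irr (e i)), tr with (e j); auto. apply He; lia.
Qed.

Lemma model_eq (i j : nat) (v w : var) :
  halting_model i v = halting_model j w <-> index i v = index j w.
Proof.
  unfold halting_model. split; [|now intros ->].
  apply chain_eq; apply index_bound.
Qed.

Lemma op_at_sem (c i : nat) : i < N ->
  op_sem (fun i => halting_model i 1) (fun i => halting_model i (enq_var c))
    (fun i => halting_model i (deq_var c)) (fun i => halting_model i 0) (op_at c i) i.
Proof.
  intros Hi.
  assert (St := dequeued_step (op_at c) (fun i => contents i c) N
                  (contents_zero _) (fun i _ => op_at_step _ i) i Hi).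
  assert (EA := index_enq c i).
  unfold op_sem. rewrite Nat.add_1_r.
  destruct (op_at c i) eqn:Eo.
  - rewrite !model_eq, !index_deq, EA, St. destruct (Nat.ltb_spec i N); [|lia].
    split; [cbn [index]; lia|]. split; auto.
    destruct (dequeued_all (op_at c) (fun i => contents i c) N
                  (contents_zero _) (fun i _ => op_at_step _ i) i Hi Eo) as (j & Hj & Ej).
    exists j. split; auto. rewrite model_eq, index_deq. congruence.
  - destruct St as (Hd & j & Hj & Ej & E). rewrite !model_eq, !index_deq, EA.
    split; auto. split; [lia|]. exists j. split; [lia|].
    rewrite model_eq, index_deq, E, index_enq, Ej.
    destruct (Nat.ltb_spec j N); [auto|lia].
  - rewrite !model_eq, index_deq, EA, St. split; auto. cbn [index]. lia.
  - rewrite !model_eq, !index_deq, EA, St. auto.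
Qed.

Lemma model_ops (R r i : nat) (o : op) :
  i < N -> (forall c, op_at c i = only o r c) -> satT lt halting_model i (ops_form R o r).
Proof.
  intros Hi Ho. unfold ops_form. rewrite sat_conj_seq. intros c _.
  rewrite sat_op, <- Ho. now apply op_at_sem.
Qed.

Lemma model_ticking (i : nat) : i < N -> satT lt halting_model i ticking.
Proof. intros Hi. simpl. rewrite model_eq. cbn [index]. lia. Qed.

Lemma model_at (q i : nat) :
  satT lt halting_model i (at_pc q) <-> m <= i /\ fst (steps P (i - m) (start m)) = q.
Proof.
  unfold at_pc. rewrite sat_eq_now, model_eq, index_at. cbn [index].
  destruct (Nat.leb_spec m i), (Nat.eqb_spec (fst (steps P (i - m) (start m))) q);
    simpl; lia.
Qed.

Lemma model_instr (R q i : nat) (ins : instr) :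
  nth_error P q = Some ins -> satT lt halting_model i (at_pc q) ->
  satT lt halting_model i (instr_form R ins).
Proof.
  intros Hq Hat. apply model_at in Hat as [Hm Hpc].
  (* From time [N] on the run stays in a halted configuration, whose counter addresses no
     instruction. *)
  assert (Hi : i < N).
  { destruct (Nat.lt_ge_cases i N) as [H|H]; auto. exfalso.
    replace (i - m) with ((i - N) + k) in Hpc by lia.
    rewrite steps_add, steps_halted in Hpc by auto. unfold halted in Hhalt. congruence. }
  split; [now apply model_ticking|].
  assert (Hcur : current i = Some ins).
  { unfold current. destruct (Nat.ltb_spec i m); [lia|]. now rewrite Hpc. }
  assert (Hop : forall c, op_at c i = match ins with
     | INC r _ => only OInc r c
     | DEC r _ _ => only (if contents i r =? 0 then OZero else ODec) r c end).
  { intros c. unfold op_at. now rewrite Hcur. }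
  assert (Hnext : forall l, l = fst (step P (steps P (i - m) (start m))) ->
    satT lt halting_model i (T_Next (at_pc l))).
  { intros l ->. change (satT lt halting_model (S i)
      (at_pc (fst (step P (steps P (i - m) (start m)))))).
    apply model_at. split; [lia|]. now replace (S i - m) with (S (i - m)) by lia. }
  assert (Hc : contents i = snd (steps P (i - m) (start m))).
  { unfold contents. destruct (Nat.ltb_spec i m); auto; lia. }
  rewrite Hc in Hop. destruct (steps P (i - m) (start m)) as [pc x]. simpl in Hpc, Hop. subst pc.
  simpl in Hnext. rewrite Hq in Hnext.
  destruct ins as [r l|r lz ln].
  - split; [now apply model_ops|now apply Hnext].
  - rewrite sat_or. destruct (x r =? 0).
    + left. split; [now apply model_ops|now apply Hnext].
    + right. split; [now apply model_ops|now apply Hnext].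
Qed.

Lemma model_monotone (i j v : nat) :
  index i v <= index j v -> ~ lt (halting_model j v) (halting_model i v).
Proof. intros H. apply chain_le; auto. apply index_bound. Qed.

Lemma halting_model_sat :
  satT lt halting_model 0 (T_And (machine_form P) (input_form m)).
Proof.
  split.
  - unfold machine_form. set (R := reg_bound P). rewrite sat_conj. simpl In.
    intros a [<-|[<-|[<-|[<-|[<-|[]]]]]].
    + split.
      * now rewrite sat_eq_now, model_eq.
      * rewrite sat_conj_seq. intros c _. rewrite sat_eq_now, model_eq, index_deq.
        apply dequeued_zero.
    + rewrite sat_always. intros i _. split; [|split].
      * simpl. now rewrite model_eq.
      * simpl. intros (j & Hj & H). revert H. apply model_monotone. cbn [index]. lia.
      * rewrite sat_conj_seq. intros c _. simpl. intros (j & Hj & H). revert H.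
        apply model_monotone. rewrite !index_deq.
        eapply (dequeued_mono _ (fun i => contents i c)); [apply contents_zero| |lia].
        intros; apply op_at_step.
    + rewrite sat_always. intros i _. rewrite sat_imp. unfold loading.
      rewrite sat_eq_now, model_eq. cbn [index].
      destruct (Nat.ltb_spec i m) as [H|H]; [|lia]. intros _.
      split; [apply model_ticking; lia|]. apply model_ops; [lia|].
      intros c. unfold op_at, current. apply Nat.ltb_lt in H. now rewrite H.
    + rewrite sat_always. intros i _. rewrite sat_conj_seq. intros q _. unfold control_form.
      destruct (nth_error P q) as [ins|] eqn:Hq.
      * rewrite sat_imp. now apply model_instr.
      * unfold t_true. now rewrite sat_eq_now.
    + rewrite sat_eventually. exists N. split; [lia|]. simpl. rewrite model_eq. cbn [index]. lia.
  - apply sat_input. split.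
    + intros j Hj. unfold loading. rewrite sat_eq_now, model_eq. cbn [index]. simpl.
      apply Nat.ltb_lt in Hj. now rewrite Hj.
    + apply model_at. simpl. rewrite Nat.sub_diag. auto.
Qed.

End Completeness.

(** * Finite chains in an infinite total order *)

Lemma insert_sorted {D : Type} (lt : D -> D -> Prop) (l : list D) (d : D) :
  strict_total_order lt -> StronglySorted lt l -> ~ In d l ->
  exists l', StronglySorted lt l' /\ length l' = S (length l) /\
    forall x, In x l' -> x = d \/ In x l.
Proof.
  intros (irr & tr & tot) Hl. induction Hl as [|a l Hl IH Ha]; intros Hd.
  - exists [d]. repeat split; simpl; try tauto; repeat constructor. firstorder.
  - rewrite Forall_forall in Ha. simpl in Hd.
    destruct (tot d a) as [H|H]; [intuition congruence| |].
    + exists (d :: a :: l). split; [|split]; auto; simpl.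
      * constructor; [constructor; auto|].
        -- now apply Forall_forall.
        -- constructor; auto. apply Forall_forall. eauto.
      * firstorder.
    + destruct IH as (l' & H1 & H2 & H3); [tauto|].
      exists (a :: l'). split; [|split]; simpl; auto.
      * constructor; auto. apply Forall_forall. intros x Hx.
        destruct (H3 x Hx) as [->|]; auto.
      * firstorder.
Qed.

(** Fresh elements are inserted into a sorted list until its length is [S n]; the default [d] of
    [nth] is read only beyond index [n]. *)
Lemma finite_chain {D : Type} (lt : D -> D -> Prop) (n : nat) :
  infinite_type D -> strict_total_order lt ->
  exists e : nat -> D, forall i j, i < j -> j <= n -> lt (e i) (e j).
Proof.
  intros Hinf Hlt.
  assert (L : forall k, exists l, StronglySorted lt l /\ length l = k).
  { induction k as [|k (l & Hl & E)].
    - exists []. split; constructor.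
    - destruct (Hinf l) as [d Hd].
      destruct (insert_sorted lt l d Hlt Hl Hd) as (l' & H1 & H2 & _).
      exists l'. split; auto. congruence. }
  destruct (L (S n)) as (l & Hl & E). destruct (Hinf []) as [d _].
  exists (fun i => nth i l d). intros i j Hij Hj. rewrite <- Nat.lt_succ_r, <- E in Hj.
  clear n E L. revert i j Hij Hj. induction Hl as [|a l Hl IH Ha]; simpl; intros i j Hij Hj; [lia|].
  destruct j as [|j]; [lia|]. destruct i as [|i].
  - rewrite Forall_forall in Ha. apply Ha, nth_In. lia.
  - apply IH; lia.
Qed.

(** For a run halting after [k] steps, infinity of the order supplies a chain with indices up to
    [S (m + k)] on which the model is built. *)
Lemma machine_form_correct {D : Type} (lt : D -> D -> Prop) (P : list instr) (m : nat) :
  infinite_type D -> strict_total_order lt ->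
  satisfiableT lt (T_And (machine_form P) (input_form m)) <-> halts P m.
Proof.
  intros Hinf Hlt. split.
  - intros (s & H1 & H2). eapply machine_form_sound; eauto.
  - intros [k Hk]. destruct (finite_chain lt (S (m + k)) Hinf Hlt) as [e He].
    exists (halting_model P m k e). now apply halting_model_sat.
Qed.

(** * Diagonalization *)

(** Stated for a translation [tr] to serve both logics. The codes need to commute with [T_And] and
    [T_Next] only, the connectives that assemble the diagonal formula from fixed pieces. *)
Lemma undecidable_of_embedding {D X : Type} (lt : D -> D -> Prop)
    (enc : X -> nat) (Sat : X -> Prop) (tr : lrcT -> X) :
  infinite_type D -> strict_total_order lt ->
  (forall a b, enc (tr (T_And a b)) = cpair 5 (cpair (enc (tr a)) (enc (tr b)))) ->
  (forall a, enc (tr (T_Next a)) = cpair 7 (enc (tr a))) ->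
  (forall a, Sat (tr a) <-> satisfiableT lt a) ->
  ~ decidable_pred enc Sat.
Proof.
  intros Hinf Hlt HAnd HNext Hsat [f Hf].
  pose (pair_with n g := PComp prf_cpair [prf_const n; g]).
  assert (Hpair : forall n g v y, eval g v y -> eval (pair_with n g) v (cpair n y)).
  { intros. eapply eval_comp2; eauto using eval_const, eval_cpair. }
  (* This recursion mirrors [input_form]; [PProj 1] reads the code obtained for the preceding
     input. *)
  pose (code_input := PRec (prf_const (enc (tr (at_pc 0))))
    (pair_with 5 (pair_with (enc (tr loading)) (pair_with 7 (PProj 1))))).
  assert (Hinput : forall m, eval code_input [m] (enc (tr (input_form m)))).
  { induction m as [|m IH]; simpl input_form.
    - apply ev_rec0, eval_const.
    - rewrite HAnd, HNext. eapply ev_recS; [exact IH|]. repeat apply Hpair. now apply eval_proj. }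
  (* On input [m] this asks [f] about the conjunction of the formula coded by [m] with
     [input_form m]. It does not mention [psi], so [psi] may be built from it. *)
  pose (diag := PComp f [pair_with 5 (PComp prf_cpair [PProj 0; code_input])]).
  pose (psi := machine_form (halt_on_zero diag)).
  pose (m := enc (tr psi)).
  pose (phi := T_And psi (input_form m)).
  assert (Hdiag : forall y, eval f [enc (tr phi)] y -> eval diag [m] y).
  { intros y Hy. eapply eval_comp1; [|exact Hy]. unfold phi. rewrite HAnd. apply Hpair.
    eapply eval_comp2; [now apply eval_proj|apply Hinput|apply eval_cpair]. }
  assert (Hphi : Sat (tr phi) <-> halts (halt_on_zero diag) m).
  { rewrite Hsat. now apply machine_form_correct. }
  destruct (Hf (tr phi)) as [Hyes Hno].
  (* Satisfiability would make [f], hence [diag], answer 1, and the machine would loop, although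
     satisfiability means that it halts. Being unsatisfiable, [phi] gets the answer 0, and the
     machine halts after all. *)
  assert (Hn : ~ Sat (tr phi)).
  { intros H. apply (halt_on_zero_loops diag m 0); [now apply Hdiag, Hyes|now apply Hphi]. }
  apply Hn, Hphi, halt_on_zero_halts. now apply Hdiag, Hno.
Qed.

(** * Embedding of the smaller logic: [L_EqX 0 0 0] is the trivially true test *)

Fixpoint lrc_of_lrcT (a : lrcT) : lrc :=
  match a with
  | T_EqX x i y => L_EqX x i y
  | T_EqXF x y => L_EqTF x (L_EqX 0 0 0) y
  | T_EqXFi x y => L_EqTP x (L_EqX 0 0 0) y
  | T_LtXF x y => L_LtXF x y
  | T_GtXF x y => L_GtXF x y
  | T_And a b => L_And (lrc_of_lrcT a) (lrc_of_lrcT b)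
  | T_Not a => L_Not (lrc_of_lrcT a)
  | T_Next a => L_Next (lrc_of_lrcT a)
  | T_Until a b => L_Until (lrc_of_lrcT a) (lrc_of_lrcT b)
  end.

Lemma sat_lrc_of_lrcT {D : Type} (lt : D -> D -> Prop) (s : model D) (a : lrcT) (i : nat) :
  satL lt s i (lrc_of_lrcT a) <-> satT lt s i a.
Proof.
  revert i. induction a as [x k y|x y|x y|x y|x y|a IHa b IHb|a IHa|a IHa|a IHa b IHb];
    intros i; simpl; try reflexivity.
  - setoid_rewrite Nat.add_0_r. firstorder.
  - setoid_rewrite Nat.add_0_r. firstorder.
  - now rewrite IHa, IHb.
  - now rewrite IHa.
  - now rewrite IHa.
  - setoid_rewrite IHa. setoid_rewrite IHb. reflexivity.
Qed.

Theorem theorem3p1p1 (D : Type) (lt : D -> D -> Prop) :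
  infinite_type D -> strict_total_order lt ->
  ~ decidable_pred code_lrc (satisfiableL lt) /\
  ~ decidable_pred code_lrcT (satisfiableT lt).
Proof.
  intros Hinf Hlt. split.
  - apply (undecidable_of_embedding lt code_lrc _ lrc_of_lrcT); auto.
    intros a. unfold satisfiableL, satisfiableT. now setoid_rewrite sat_lrc_of_lrcT.
  - apply (undecidable_of_embedding lt code_lrcT _ (fun a => a)); auto. reflexivity.
Qed.
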